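(* For any $a,q,k\in\mathbb{N}$, there exist infinitely many $n\in\mathbb{N}$ such that $\Omega(an+k)\equiv\Omega(an)\pmod q$.
   Context: $\mathbb{N}=\{1,2,\dots\}$. For $n\in\mathbb{N}$, $\Omega(n)$ is the number of prime factors of $n$ counted with multiplicity. *)

(* Defs.v *)
From mathcomp Require Import all_boot.

Set Implicit Arguments.
Unset Strict Implicit.
Unset Printing Implicit Defensive.

(* Equal to 0 at n = 0, a value outside the mathematical domain. *)
Definition bigOmega (n : nat) : nat := \sum_(p <- primes n) logn p n.

(* Main.v *)
Require Import Defs.
From mathcomp Require Import all_boot.

(** The number of prime factors counted with multiplicity is completely
    additive.  Call x < y a good pair when a (y - x) divides k x, say
    k x = n a (y - x).  Then
      k x = (a n) (y - x)   and   k y = k x + k (y - x) = (a n + k) (y - x),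
    so that cancelling the common factors k and y - x gives
      bigOmega (a n + k) - bigOmega (a n) = bigOmega y - bigOmega x.
    Hence it suffices to find one good pair whose entries have the same number
    of prime factors modulo q.  There are arbitrarily long sequences of positive
    integers all of whose pairs are good ([good_seq_exists]), and the pigeonhole
    principle on a sequence of length q + 1 yields the wanted pair.

    This produces one positive n for each a ([congruent_shift_exists]).
    Infinitely many come for free, because a may be replaced by a (N + 1): a
    solution m for a (N + 1) gives the solution (N + 1) m > N for a. *)

(** Summing over an interval that does not depend on the primes of n makes the
    sums for m, n and m * n comparable term by term. *)
Lemma bigOmega_widen n b : n < b -> bigOmega n = \sum_(0 <= p < b) logn p n.
Proof.
move=> ltnb; rewrite /bigOmega [RHS](bigID (mem (primes n))) /=.
rewrite [X in _ = _ + X]big1 ?addn0; last first.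
  by move=> p; rewrite -logn_gt0 lt0n negbK => /eqP.
rewrite -[RHS]big_filter; apply/perm_big/uniq_perm; rewrite ?primes_uniq //.
  by rewrite filter_uniq ?iota_uniq.
move=> p; rewrite mem_filter mem_index_iota /=.
case pP: (p \in primes n) => //=; move: pP; rewrite mem_primes.
by case/and3P=> _ n_gt0 /(dvdn_leq n_gt0) lepn; rewrite (leq_ltn_trans lepn).
Qed.

Lemma bigOmegaM m n : 0 < m -> 0 < n ->
  bigOmega (m * n) = bigOmega m + bigOmega n.
Proof.
move=> m_gt0 n_gt0.
rewrite !(@bigOmega_widen _ (m * n).+1) ?ltnS ?leq_pmulr ?leq_pmull //.
by rewrite -big_split; apply: eq_bigr => p _; rewrite lognM.
Qed.

Definition good_pair (a k : nat) : rel nat :=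
  fun x y => (x < y) && (a * (y - x) %| k * x).

Lemma good_pair_congruent_shift a q k x y : 0 < a -> 0 < k -> 0 < x ->
    good_pair a k x y -> bigOmega x = bigOmega y %[mod q] ->
  exists2 n, 0 < n & bigOmega (a * n + k) = bigOmega (a * n) %[mod q].
Proof.
move=> a_gt0 k_gt0 x_gt0 /andP[ltxy /dvdnP[n kxE]] eq_xy.
have y_gt0 : 0 < y by apply: ltn_trans ltxy.
have d_gt0 : 0 < y - x by rewrite subn_gt0.
have n_gt0 : 0 < n.
  by case: n kxE => // /eqP; rewrite mul0n muln_eq0 !gtn_eqF.
exists n => //.
have an_gt0 : 0 < a * n by rewrite muln_gt0 a_gt0.
have kxF : k * x = a * n * (y - x) by rewrite kxE mulnCA mulnA.
have kyF : k * y = (a * n + k) * (y - x).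
  by rewrite mulnDl -kxF -mulnDr subnKC // ltnW.
have Omx : bigOmega k + bigOmega x = bigOmega (a * n) + bigOmega (y - x).
  by rewrite -!bigOmegaM // kxF.
have Omy : bigOmega k + bigOmega y = bigOmega (a * n + k) + bigOmega (y - x).
  by rewrite -!bigOmegaM ?addn_gt0 ?an_gt0 // kyF.
apply/eqP; rewrite -(eqn_modDr (bigOmega (y - x))) -Omx -Omy eqn_modDl.
by rewrite eq_xy.
Qed.

(** The translation keeps y - x, and a (y - x) divides k (L + x) because it
    divides k x, which in turn divides k L. *)
Lemma good_pairD a k L x y : a * x %| L ->
  good_pair a k x y -> good_pair a k (L + x) (L + y).
Proof.
move=> dvdL /andP[ltxy dvdx]; rewrite /good_pair ltn_add2l ltxy subnDl /=.
rewrite mulnDr dvdn_addl // (dvdn_trans dvdx) // dvdn_mul //.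
by rewrite (dvdn_trans _ dvdL) // dvdn_mull.
Qed.

(** A good sequence s is prolonged by translating it by a multiple L of all the
    a x with x in s, and putting L itself in front: the new differences are the
    elements x of s, and a x divides L. *)
Lemma good_seq_exists a k m : 0 < a ->
  exists s, [/\ size s = m, all (leq 1) s & pairwise (good_pair a k) s].
Proof.
move=> a_gt0; elim: m => [|m [s [sz_s s_gt0 good_s]]]; first by exists [::].
pose L := a * \prod_(x <- s) x.
have dvdL x : x \in s -> a * x %| L.
  by move=> xs; rewrite dvdn_mul // (big_rem x) //= dvdn_mulr.
have L_gt0 : 0 < L.
  by rewrite muln_gt0 a_gt0 big_seq prodn_cond_gt0 // => x /(allP s_gt0).
exists (L :: map (addn L) s); split; first by rewrite /= size_map sz_s.
  rewrite /= L_gt0 all_map; apply/allP => x _ /=.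
  by rewrite addn_gt0 L_gt0.
rewrite pairwise_cons all_map pairwise_map; apply/andP; split.
  apply/allP => x xs /=; rewrite /good_pair -[X in X < _]addn0 ltn_add2l.
  by rewrite (allP s_gt0) // addKn dvdn_mull ?dvdL.
apply: sub_in_pairwise good_s; last exact/allP/dvdL.
by move=> x y dvd_x _; apply: good_pairD.
Qed.

Lemma congruent_shift_exists a q k : 0 < a -> 0 < q -> 0 < k ->
  exists2 n, 0 < n & bigOmega (a * n + k) = bigOmega (a * n) %[mod q].
Proof.
move=> a_gt0 q_gt0 k_gt0.
have [s [sz_s s_gt0 good_s]] := good_seq_exists a k q.+1 a_gt0.
pose r x := bigOmega x %% q.
have /(uniqPn 0)[i [j [ltij]]] : ~~ uniq (map r s).
  have r_lt : {subset map r s <= iota 0 q}.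
    by move=> _ /mapP[x _ ->]; rewrite mem_iota ltn_mod.
  apply/negP => /uniq_leq_size /(_ r_lt).
  by rewrite size_map sz_s size_iota ltnn.
rewrite size_map => ltjs; have ltis := ltn_trans ltij ltjs.
rewrite !(nth_map 0) // => eq_ij.
apply: good_pair_congruent_shift eq_ij => //.
  by rewrite (allP s_gt0) ?mem_nth.
by move/(pairwiseP 0): good_s; apply.
Qed.

Theorem corollary1p8 (a q k : nat) (ha : 0 < a) (hq : 0 < q) (hk : 0 < k) :
  forall N : nat, exists n : nat,
    N < n /\ bigOmega (a * n + k) = bigOmega (a * n) %[mod q].
Proof.
move=> N.
have aN_gt0 : 0 < a * N.+1 by rewrite muln_gt0 ha.
have [m m_gt0 eq_m] := congruent_shift_exists (a * N.+1) q k aN_gt0 hq hk.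
by exists (N.+1 * m); rewrite mulnA leq_pmulr.
Qed.
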